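(* Let $\mathcal{C},\mathcal{B}$ be symmetric monoidal categories, let $(F,F^2,F^0):\mathcal{C}\to\mathcal{B}$ be a braided comonoidal functor, and let $A^0$ be the class of all $F$-adapted cocommutative comonoids in $\mathcal{C}$. For any $(x,\Delta_x,\varepsilon_x)$, $(y,\Delta_y,\varepsilon_y)$, $(z,\Delta_z,\varepsilon_z)$ in $A^0$ set $A_{x,y}:=F(x\otimes y)$ and \begin{align*} \Delta_{x,y} &= F^2(x\otimes y,x\otimes y)\circ F(\mathrm{id}_x\otimes\sigma_{x,y}\otimes\mathrm{id}_y)\circ F(\Delta_x\otimes\Delta_y),\\ \varepsilon_{x,y} &= F^0\circ F(\varepsilon_x\otimes\varepsilon_y),\\ m_{x,y,z} &= F(\mathrm{id}_x\otimes\varepsilon_y\otimes\mathrm{id}_z)\circ(\gamma^{y}_{x,z})^{-1}: A_{x,y}\otimes A_{y,z}\to A_{x,z},\\ u_x &= F(\Delta_x)\circ(\chi_x)^{-1}: I\to A_{x,x},\\ S_{x,y} &= F(\sigma_{x,y}): A_{x,y}\to A_{y,x}. \end{align*} Then $(A^0, A^1=\{A_{x,y}\}, m=\{m_{x,y,z}\}, u=\{u_x\}, S=\{S_{x,y}\})$, where each $A_{x,y}$ carries the comultiplication $\Delta_{x,y}$ and the counit $\varepsilon_{x,y}$, is a Hopf $\mathcal{B}$-category.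
   Context: Conventions. All symmetric monoidal categories are strict (associativity and unit constraints are identities); tensor product, unit and braiding are denoted $\otimes, I,\sigma$ in every category. Comonoids. A comonoid in $\mathcal{C}$ is a triple $(M,\Delta,\varepsilon)$ with $\Delta:M\to M\otimes M$, $\varepsilon:M\to I$ such that $(\mathrm{id}\otimes\Delta)\circ\Delta=(\Delta\otimes\mathrm{id})\circ\Delta$ and $(\varepsilon\otimes\mathrm{id})\circ\Delta=\mathrm{id}=(\mathrm{id}\otimes\varepsilon)\circ\Delta$; it is cocommutative if $\sigma_{M,M}\circ\Delta=\Delta$. A morphism of comonoids $f:M\to M'$ satisfies $(f\otimes f)\circ\Delta=\Delta'\circ f$ and $\varepsilon'\circ f=\varepsilon$. The tensor product $M\otimes M'$ of comonoids is a comonoid with comultiplication $(\mathrm{id}\otimes\sigma\otimes\mathrm{id})\circ(\Delta\otimes\Delta')$ and counit $\varepsilon\otimes\varepsilon'$; $I$ is a comonoid in the trivial way. Comonoids in $\mathcal{C}$ and their morphisms form a symmetric monoidal category $\mathrm{Com}(\mathcal{C})$. Braided comonoidal functors. A braided comonoidal functor $(F,F^2,F^0):\mathcal{C}\to\mathcal{B}$ is a functor $F$ with a morphism $F^0:F(I)\to I$ and a natural transformation $F^2(X,Y):F(X\otimes Y)\to F(X)\otimes F(Y)$ such that for all objects $X,Y,Z$: $(\mathrm{id}\otimes F^2(Y,Z))\circ F^2(X,Y\otimes Z)=(F^2(X,Y)\otimes\mathrm{id})\circ F^2(X\otimes Y,Z)$; $\sigma_{F(X),F(Y)}\circ F^2(X,Y)=F^2(Y,X)\circ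 F(\sigma_{X,Y})$; $(F^0\otimes\mathrm{id})\circ F^2(I,X)=\mathrm{id}$ and $(\mathrm{id}\otimes F^0)\circ F^2(X,I)=\mathrm{id}$. ($F^2$ and $F^0$ are not assumed invertible.) $F$-adapted comonoids. A comonoid $(M,\Delta,\varepsilon)$ in $\mathcal{C}$ is $F$-adapted (equivalently $F$ is $M$-adapted) if for all objects $X,Y$ of $\mathcal{C}$ the following morphisms are invertible: $\chi_M:=F^0\circ F(\varepsilon):F(M)\to I$ and $\gamma^M_{X,Y}:=F^2(X\otimes M,M\otimes Y)\circ F(\mathrm{id}_X\otimes\Delta\otimes\mathrm{id}_Y):F(X\otimes M\otimes Y)\to F(X\otimes M)\otimes F(M\otimes Y)$. Hopf categories. For a symmetric monoidal category $\mathcal{V}$, a $\mathcal{V}$-category $(A^0,A^1,m,u)$ consists of a class $A^0$ (the underlying class), objects $A_{x,y}$ of $\mathcal{V}$ for $x,y\in A^0$, morphisms $m_{x,y,z}:A_{x,y}\otimes A_{y,z}\to A_{x,z}$ and $u_x:I\to A_{x,x}$ such that $m_{x,z,w}\circ(m_{x,y,z}\otimes\mathrm{id})=m_{x,y,w}\circ(\mathrm{id}\otimes m_{y,z,w})$, $m_{x,x,y}\circ(u_x\otimes\mathrm{id})=\mathrm{id}$ and $m_{x,y,y}\circ(\mathrm{id}\otimes u_y)=\mathrm{id}$ for all $x,y,z,w$. A semi-Hopf $\mathcal{B}$-category is a $\mathrm{Com}(\mathcal{B})$-category, i.e. each $A_{x,y}$ is a comonoid $(A_{x,y},\Delta_{x,y},\varepsilon_{x,y})$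 in $\mathcal{B}$ and all $m_{x,y,z}$, $u_x$ are morphisms of comonoids. A Hopf $\mathcal{B}$-category is a semi-Hopf $\mathcal{B}$-category with morphisms $S_{x,y}:A_{x,y}\to A_{y,x}$ in $\mathcal{B}$ such that for all $x,y$: $m_{x,y,x}\circ(\mathrm{id}\otimes S_{x,y})\circ\Delta_{x,y}=u_x\circ\varepsilon_{x,y}$ and $m_{y,x,y}\circ(S_{x,y}\otimes\mathrm{id})\circ\Delta_{x,y}=u_y\circ\varepsilon_{x,y}$. *)

(* Defs.v *)
From Corelib Require Import ssreflect.
From Stdlib Require Import IndefiniteDescription.

Set Implicit Arguments.
Unset Strict Implicit.
Unset Printing Implicit Defensive.

Declare Scope cat_scope.
Delimit Scope cat_scope with cat.
Local Open Scope cat_scope.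

Reserved Notation "g ∘ f" (at level 50, left associativity).
Reserved Notation "X ⊗ Y" (at level 40, left associativity).
Reserved Notation "f ⊗₁ g" (at level 40, left associativity).
Reserved Notation "f ≡ g" (at level 70, no associativity).

Record category := Category {
  ob :> Type;
  hom : ob -> ob -> Type;
  idm : forall X, hom X X;
  comp : forall X Y Z, hom Y Z -> hom X Y -> hom X Z;
  compA : forall X Y Z W (h : hom Z W) (g : hom Y Z) (f : hom X Y),
    comp h (comp g f) = comp (comp h g) f;
  comp1m : forall X Y (f : hom X Y), comp (idm Y) f = f;
  compm1 : forall X Y (f : hom X Y), comp f (idm X) = f
}.

Arguments hom {c} X Y.
Arguments idm {c} X.
Arguments comp {c X Y Z} g f.

Notation "g ∘ f" := (comp g f) : cat_scope.

(* Equality of arrows whose sources (resp. targets) are equal objects that need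
   not be convertible, as happens with (X ⊗ Y) ⊗ Z and X ⊗ (Y ⊗ Z) in a strict
   monoidal category. *)
Inductive arrow_eq (C : category) (X Y : C) (f : hom X Y) :
    forall X' Y' : C, hom X' Y' -> Prop :=
  arrow_eq_refl : arrow_eq f f.

Notation "f ≡ g" := (arrow_eq f g) : cat_scope.

(* The identity arrow, seen as an arrow between two equal objects. *)
Definition idto (C : category) (X Y : C) (e : X = Y) : hom X Y :=
  match e in _ = Y' return hom X Y' with eq_refl => idm X end.

Definition is_inverse (C : category) (X Y : C) (f : hom X Y) (g : hom Y X) :
    Prop :=
  g ∘ f = idm X /\ f ∘ g = idm Y.

Definition invertible (C : category) (X Y : C) (f : hom X Y) : Prop :=
  exists g : hom Y X, is_inverse f g.

Definition inv (C : category) (X Y : C) (f : hom X Y) (fV : invertible f) :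
    hom Y X :=
  proj1_sig (constructive_indefinite_description _ fV).

Lemma invP (C : category) (X Y : C) (f : hom X Y) (fV : invertible f) :
  is_inverse f (inv fV).
Proof. exact: proj2_sig (constructive_indefinite_description _ fV). Qed.

(* Strict symmetric monoidal categories.  The unit law σ_{X,I} = id and the
   second hexagon follow from the laws below. *)
Record smcat := SMCat {
  smcat_cat :> category;
  tens : smcat_cat -> smcat_cat -> smcat_cat;
  unit_ob : smcat_cat;
  tensm : forall X X' Y Y' : smcat_cat,
    hom X X' -> hom Y Y' -> hom (tens X Y) (tens X' Y');
  braid : forall X Y : smcat_cat, hom (tens X Y) (tens Y X);
  tensm_id : forall X Y : smcat_cat,
    tensm (idm X) (idm Y) = idm (tens X Y);
  tensm_comp : forall (X X' X'' Y Y' Y'' : smcat_cat)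
      (f' : hom X' X'') (f : hom X X') (g' : hom Y' Y'') (g : hom Y Y'),
    tensm (f' ∘ f) (g' ∘ g) = tensm f' g' ∘ tensm f g;
  tensA : forall X Y Z : smcat_cat, tens (tens X Y) Z = tens X (tens Y Z);
  tens1o : forall X : smcat_cat, tens unit_ob X = X;
  tenso1 : forall X : smcat_cat, tens X unit_ob = X;
  tensmA : forall (X X' Y Y' Z Z' : smcat_cat)
      (f : hom X X') (g : hom Y Y') (h : hom Z Z'),
    tensm (tensm f g) h ≡ tensm f (tensm g h);
  tens1m : forall (X X' : smcat_cat) (f : hom X X'),
    tensm (idm unit_ob) f ≡ f;
  tensm1 : forall (X X' : smcat_cat) (f : hom X X'),
    tensm f (idm unit_ob) ≡ f;
  braid_nat : forall (X X' Y Y' : smcat_cat) (f : hom X X') (g : hom Y Y'),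
    braid X' Y' ∘ tensm f g = tensm g f ∘ braid X Y;
  braidK : forall X Y : smcat_cat, braid Y X ∘ braid X Y = idm (tens X Y);
  braid_hexagon : forall X Y Z : smcat_cat,
    braid X (tens Y Z)
    ≡ tensm (idm Y) (braid X Z) ∘ idto (tensA Y X Z)
        ∘ tensm (braid X Y) (idm Z)
}.

Arguments tens {s} X Y.
Arguments unit_ob {s}.
Arguments tensm {s X X' Y Y'} f g.
Arguments braid {s} X Y.
Arguments tensA {s} X Y Z.
Arguments tens1o {s} X.
Arguments tenso1 {s} X.

Notation "X ⊗ Y" := (tens X Y) : cat_scope.
Notation "f ⊗₁ g" := (tensm f g) : cat_scope.

Section Rebracketing.
Variable C : smcat.

Lemma tens_split_mid (X M N Y : C) : X ⊗ (M ⊗ N) ⊗ Y = (X ⊗ M) ⊗ (N ⊗ Y).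
Proof. by rewrite !tensA. Qed.

Lemma tens_join_mid (X M N Y : C) : (X ⊗ M) ⊗ (N ⊗ Y) = X ⊗ (M ⊗ N) ⊗ Y.
Proof. by rewrite !tensA. Qed.

Lemma tens_unit_mid (X Y : C) : X ⊗ unit_ob ⊗ Y = X ⊗ Y.
Proof. by rewrite tenso1. Qed.

End Rebracketing.

(* id ⊗ σ ⊗ id, with σ exchanging the two factors in the middle. *)
Definition midswap (C : smcat) (X M N Y : C) :
    hom ((X ⊗ M) ⊗ (N ⊗ Y)) ((X ⊗ N) ⊗ (M ⊗ Y)) :=
  idto (tens_split_mid X N M Y)
  ∘ (idm X ⊗₁ braid M N ⊗₁ idm Y)
  ∘ idto (tens_join_mid X M N Y).

Section Comonoids.
Variable C : smcat.

Record is_comonoid (M : C) (D : hom M (M ⊗ M)) (e : hom M unit_ob) : Prop :=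
  IsComonoid {
    comulA : (idm M ⊗₁ D) ∘ D ≡ (D ⊗₁ idm M) ∘ D;
    counitl : (e ⊗₁ idm M) ∘ D ≡ idm M;
    counitr : (idm M ⊗₁ e) ∘ D ≡ idm M
  }.

Definition is_cocommutative (M : C) (D : hom M (M ⊗ M)) : Prop :=
  braid M M ∘ D = D.

Definition is_comonoid_morphism
    (M : C) (D : hom M (M ⊗ M)) (e : hom M unit_ob)
    (M' : C) (D' : hom M' (M' ⊗ M')) (e' : hom M' unit_ob)
    (f : hom M M') : Prop :=
  (f ⊗₁ f) ∘ D = D' ∘ f /\ e' ∘ f = e.

Definition tens_comul (M M' : C) (D : hom M (M ⊗ M)) (D' : hom M' (M' ⊗ M')) :
    hom (M ⊗ M') ((M ⊗ M') ⊗ (M ⊗ M')) :=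
  midswap M M M' M' ∘ (D ⊗₁ D').

Definition tens_counit (M M' : C) (e : hom M unit_ob) (e' : hom M' unit_ob) :
    hom (M ⊗ M') unit_ob :=
  idto (tens1o unit_ob) ∘ (e ⊗₁ e').

Definition unit_comul : hom (unit_ob : C) (unit_ob ⊗ unit_ob) :=
  idto (eq_sym (tens1o unit_ob)).

Definition unit_counit : hom (unit_ob : C) unit_ob := idm unit_ob.

Record comonoid := Comonoid {
  carrier :> C;
  comul : hom carrier (carrier ⊗ carrier);
  counit : hom carrier unit_ob;
  comonoidP : is_comonoid comul counit
}.

End Comonoids.

Arguments comul {C} c.
Arguments counit {C} c.

Record functor (C B : category) := Functor {
  fob :> C -> B;
  fmap : forall X Y : C, hom X Y -> hom (fob X) (fob Y);
  fmap_id : forall X : C, fmap (idm X) = idm (fob X);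
  fmap_comp : forall (X Y Z : C) (g : hom Y Z) (f : hom X Y),
    fmap (g ∘ f) = fmap g ∘ fmap f
}.

Arguments fmap {C B} _ {X Y} _.

Record braided_comonoidal_functor (C B : smcat) := BraidedComonoidalFunctor {
  bc_functor :> functor C B;
  F0 : hom (bc_functor unit_ob) unit_ob;
  F2 : forall X Y : C, hom (bc_functor (X ⊗ Y)) (bc_functor X ⊗ bc_functor Y);
  F2_nat : forall (X X' Y Y' : C) (f : hom X X') (g : hom Y Y'),
    F2 X' Y' ∘ fmap bc_functor (f ⊗₁ g)
    = (fmap bc_functor f ⊗₁ fmap bc_functor g) ∘ F2 X Y;
  F2_coassoc : forall X Y Z : C,
    (idm (bc_functor X) ⊗₁ F2 Y Z) ∘ F2 X (Y ⊗ Z)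
    ≡ (F2 X Y ⊗₁ idm (bc_functor Z)) ∘ F2 (X ⊗ Y) Z;
  F2_braid : forall X Y : C,
    braid (bc_functor X) (bc_functor Y) ∘ F2 X Y
    = F2 Y X ∘ fmap bc_functor (braid X Y);
  F2_counitl : forall X : C,
    (F0 ⊗₁ idm (bc_functor X)) ∘ F2 unit_ob X ≡ idm (bc_functor X);
  F2_counitr : forall X : C,
    (idm (bc_functor X) ⊗₁ F0) ∘ F2 X unit_ob ≡ idm (bc_functor X)
}.

Arguments F0 {C B} b.
Arguments F2 {C B} b X Y.

Section Adapted.
Variables (C B : smcat) (F : braided_comonoidal_functor C B).

Definition chi (M : comonoid C) : hom (F M) unit_ob :=
  F0 F ∘ fmap F (counit M).

Definition gamma (M : comonoid C) (X Y : C) :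
    hom (F (X ⊗ M ⊗ Y)) (F (X ⊗ M) ⊗ F (M ⊗ Y)) :=
  F2 F (X ⊗ M) (M ⊗ Y)
  ∘ fmap F (idto (tens_split_mid X M M Y) ∘ (idm X ⊗₁ comul M ⊗₁ idm Y)).

Record is_adapted (M : comonoid C) : Prop := IsAdapted {
  chi_invertible : invertible (chi M);
  gamma_invertible : forall X Y : C, invertible (gamma M X Y)
}.

Record adapted_cocomm_comonoid := AdaptedCocommComonoid {
  acc_comonoid :> comonoid C;
  acc_cocomm : is_cocommutative (comul acc_comonoid);
  acc_adapted : is_adapted acc_comonoid
}.

End Adapted.

Section HopfCategories.
Variables (V : smcat) (A0 : Type) (A : A0 -> A0 -> V).
Variables (m : forall x y z, hom (A x y ⊗ A y z) (A x z))
          (u : forall x, hom unit_ob (A x x)).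

Record is_enriched_category : Prop := IsEnrichedCategory {
  enr_assoc : forall x y z w : A0,
    m x z w ∘ (m x y z ⊗₁ idm (A z w)) ≡ m x y w ∘ (idm (A x y) ⊗₁ m y z w);
  enr_unitl : forall x y : A0, m x x y ∘ (u x ⊗₁ idm (A x y)) ≡ idm (A x y);
  enr_unitr : forall x y : A0, m x y y ∘ (idm (A x y) ⊗₁ u y) ≡ idm (A x y)
}.

Variables (D : forall x y, hom (A x y) (A x y ⊗ A x y))
          (e : forall x y, hom (A x y) unit_ob).

(* A category enriched in the comonoids of V: composition and tensor product of
   comonoid morphisms are those of V, so that the laws of an enriched category
   are equations between the underlying arrows of V. *)
Record is_semi_hopf_category : Prop := IsSemiHopfCategory {
  semi_hopf_enriched : is_enriched_category;
  semi_hopf_comonoid : forall x y : A0, is_comonoid (D x y) (e x y);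
  semi_hopf_mul : forall x y z : A0,
    is_comonoid_morphism
      (tens_comul (D x y) (D y z)) (tens_counit (e x y) (e y z))
      (D x z) (e x z) (m x y z);
  semi_hopf_unit : forall x : A0,
    is_comonoid_morphism (unit_comul V) (unit_counit V) (D x x) (e x x) (u x)
}.

Variable S : forall x y, hom (A x y) (A y x).

Record is_hopf_category : Prop := IsHopfCategory {
  hopf_semi_hopf : is_semi_hopf_category;
  hopf_antipoder : forall x y : A0,
    m x y x ∘ (idm (A x y) ⊗₁ S x y) ∘ D x y = u x ∘ e x y;
  hopf_antipodel : forall x y : A0,
    m y x y ∘ (S x y ⊗₁ idm (A x y)) ∘ D x y = u y ∘ e x y
}.

End HopfCategories.

Arguments is_enriched_category {V A0} A m u.
Arguments is_semi_hopf_category {V A0} A m u D e.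
Arguments is_hopf_category {V A0} A m u D e S.

Section Construction.
Variables (C B : smcat) (F : braided_comonoidal_functor C B).
Implicit Types x y z : adapted_cocomm_comonoid F.

Definition hopf_hom x y : B := F (x ⊗ y).

Definition hopf_comul x y : hom (hopf_hom x y) (hopf_hom x y ⊗ hopf_hom x y) :=
  F2 F (x ⊗ y) (x ⊗ y)
  ∘ fmap F (midswap x x y y)
  ∘ fmap F (comul x ⊗₁ comul y).

Definition hopf_counit x y : hom (hopf_hom x y) unit_ob :=
  F0 F ∘ fmap F (idto (tens1o unit_ob) ∘ (counit x ⊗₁ counit y)).

Definition hopf_mul x y z :
    hom (hopf_hom x y ⊗ hopf_hom y z) (hopf_hom x z) :=
  fmap F (idto (tens_unit_mid x z) ∘ (idm x ⊗₁ counit y ⊗₁ idm z))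
  ∘ inv (gamma_invertible (acc_adapted y) x z).

Definition hopf_unit x : hom unit_ob (hopf_hom x x) :=
  fmap F (comul x) ∘ inv (chi_invertible (acc_adapted x)).

Definition hopf_antipode x y : hom (hopf_hom x y) (hopf_hom y x) :=
  fmap F (braid x y).

End Construction.

(* Main.v *)
From Corelib Require Import ssreflect.
From Stdlib Require Import ClassicalEpsilon Eqdep.
Require Import Defs.

(* The functor F sends the tensor comonoids x ⊗ y to comonoids, because F2 is
   compatible with the middle exchange.  Cocommutativity of y makes its
   comultiplication a comonoid morphism, hence so is the isomorphism γ^y, and with
   it the multiplication F(x ⊗ ε ⊗ z) ∘ (γ^y)^-1; likewise for the unit.  Every
   equation involving the multiplication is checked after precomposition with γ,
   where it becomes the image under F of an equation in C: associativity follows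
   from the coassociativity of γ, and the antipode laws from the hexagon, which
   turns (id ⊗ σ) ∘ (id ⊗ σ ⊗ id) ∘ (Δ ⊗ Δ) into
   (id ⊗ Δ ⊗ id) ∘ (id ⊗ σ) ∘ (Δ ⊗ id). *)

Set Implicit Arguments.
Unset Strict Implicit.
Unset Printing Implicit Defensive.
Local Open Scope cat_scope.

(* Arrows with unrestricted operations: composition compares the middle objects
   up to propositional equality and is undefined when they differ.  The
   associativity and unit isomorphisms, which are identities between objects that
   are equal but not convertible, thereby disappear from all equations. *)
Inductive arr (C : category) : Type :=
| Arr (X Y : C) (f : hom X Y)
| Undef.
Arguments Arr {C X Y} f.
Arguments Undef {C}.

Definition acomp (C : category) (g f : arr C) : arr C :=
  match g, f with
  | @Arr _ Y' Z g, @Arr _ X Y f =>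
      match excluded_middle_informative (Y = Y') with
      | left e => Arr (g ∘ (idto e ∘ f))
      | right _ => Undef
      end
  | _, _ => Undef
  end.

Definition atens (C : smcat) (f g : arr C) : arr C :=
  match f, g with
  | Arr f, Arr g => Arr (f ⊗₁ g)
  | _, _ => Undef
  end.

Notation "g • f" := (acomp g f) (at level 50, left associativity) : cat_scope.
Notation "f ⊠ g" := (atens f g) (at level 40, left associativity) : cat_scope.

(** No typing exists for [Undef], so a typed expression is one in which every composition is
    defined. *)
Definition typ (C : category) (a : arr C) (X Y : C) : Prop :=
  exists f : hom X Y, a = Arr f.

(** * Calculus of untyped arrows in a category *)

Section Arrows.
Variable C : category.
Implicit Types (X Y Z : C) (a b c : arr C).

Definition aid X : arr C := Arr (idm X).

Lemma arr_eqE X Y X' Y' (f : hom X Y) (g : hom X' Y') :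
  Arr f = Arr g -> f ≡ g.
Proof.
(* The goal becomes a property of the value [Arr g], which the hypothesis can rewrite without any
   dependent elimination. *)
move=> fg; change (match Arr g with Arr h => f ≡ h | Undef => False end).
by rewrite -fg.
Qed.

Lemma Arr_arr_eq X Y X' Y' (f : hom X Y) (g : hom X' Y') :
  f ≡ g -> Arr f = Arr g.
Proof. by case. Qed.

Lemma Arr_inj X Y (f g : hom X Y) : Arr f = Arr g -> f = g.
Proof.
by move=> [fg]; apply: inj_pair2 (inj_pair2 _ _ _ _ _ fg).
Qed.

Lemma Arr_comp X Y Z (g : hom Y Z) (f : hom X Y) : Arr (g ∘ f) = Arr g • Arr f.
Proof.
rewrite /=; case: excluded_middle_informative => // e.
by rewrite (UIP_refl _ _ e) /= comp1m.
Qed.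

Lemma Arr_idto X Y (e : X = Y) : Arr (idto e) = aid X.
Proof. by case: Y / e. Qed.

Lemma Arr_idto_l X Y Z (e : Y = Z) (f : hom X Y) :
  Arr (idto e ∘ f) = Arr f.
Proof. by case: Z / e; rewrite comp1m. Qed.

Lemma Arr_idto_r X Y Z (e : X = Y) (f : hom Y Z) :
  Arr (f ∘ idto e) = Arr f.
Proof. by case: Y / e f => f; rewrite compm1. Qed.

(** Unconditional: if one of the two meeting points does not match, both sides are [Undef];
    otherwise the object equalities chosen on the two sides agree by UIP. *)
Lemma acompA c b a : c • (b • a) = c • b • a.
Proof.
case: c b a => [Z' W h|] [Y' Z g|] [X Y f|] //=;
  repeat (case: excluded_middle_informative => //= ?).
by rewrite !compA; congr (Arr (_ ∘ idto _ ∘ _)); exact: UIP.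
Qed.

Lemma typ_Arr X Y (f : hom X Y) : typ (Arr f) X Y.
Proof. by exists f. Qed.

Lemma typ_aid X : typ (aid X) X X.
Proof. exact: typ_Arr. Qed.

Lemma typ_comp a b X Y Y' Z :
  typ a X Y -> typ b Y' Z -> Y = Y' -> typ (b • a) X Z.
Proof.
move=> [f ->] [g ->] e; case: Y' / e g => g.
by exists (g ∘ f); rewrite Arr_comp.
Qed.

Lemma typ_conv a X Y X' Y' : typ a X' Y' -> X' = X -> Y' = Y -> typ a X Y.
Proof. by move=> ta <- <-. Qed.

Lemma typ_unique a X Y X' Y' : typ a X Y -> typ a X' Y' -> X = X' /\ Y = Y'.
Proof. by move=> [f ->] [g] []. Qed.

(** Side condition of the unit and interchange laws. The objects stay existential so that a hint can
    find them by inferring types. *)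
Definition composable b a : Prop :=
  exists X Y Z, typ a X Y /\ typ b Y Z.

Lemma acomp1l a Y : composable (aid Y) a -> aid Y • a = a.
Proof.
move=> [X [Y' [Z [[f ->] tY]]]]; have [eY _] := typ_unique tY (typ_aid Y).
by case: Y / eY tY => _; rewrite -Arr_comp comp1m.
Qed.

Lemma acomp1r a X : composable a (aid X) -> a • aid X = a.
Proof.
move=> [X' [Y [Z [tX [f ->]]]]]; have [_ eX] := typ_unique tX (typ_aid X).
by case: X / eX tX => _; rewrite -Arr_comp compm1.
Qed.

Definition ainverse a b X Y : Prop :=
  typ a X Y /\ typ b Y X /\ b • a = aid X /\ a • b = aid Y.

Lemma ainverse_inv X Y (f : hom X Y) (fV : invertible f) :
  ainverse (Arr f) (Arr (inv fV)) X Y.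
Proof.
have [fK Kf] := invP fV.
by split; last split; last split;
  rewrite -?Arr_comp ?fK ?Kf; try exact: typ_Arr.
Qed.

End Arrows.
Arguments acomp : simpl never.

Ltac objeq := first [reflexivity | rewrite ?tensA ?tens1o ?tenso1; reflexivity].

(** * Tensor product and braiding of untyped arrows *)

Section Monoidal.
Variable C : smcat.
Implicit Types (X Y Z : C) (a b c f g h : arr C).

Definition abraid X Y : arr C := Arr (braid X Y).

Lemma Arr_tens X X' Y Y' (f : hom X X') (g : hom Y Y') :
  Arr (f ⊗₁ g) = Arr f ⊠ Arr g.
Proof. by []. Qed.

Lemma typ_tens f g X X' Y Y' :
  typ f X X' -> typ g Y Y' -> typ (f ⊠ g) (X ⊗ Y) (X' ⊗ Y').
Proof. by move=> [f' ->] [g' ->]; exists (f' ⊗₁ g'). Qed.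

Lemma typ_braid X Y : typ (abraid X Y) (X ⊗ Y) (Y ⊗ X).
Proof. exact: typ_Arr. Qed.

Lemma atensA f g h : f ⊠ g ⊠ h = f ⊠ (g ⊠ h).
Proof. by case: f g h => [? ? f|] [? ? g|] [? ? h|] //=; exact/Arr_arr_eq/tensmA. Qed.

Lemma atens1l f : aid unit_ob ⊠ f = f.
Proof. by case: f => [? ? f|] //=; exact/Arr_arr_eq/tens1m. Qed.

Lemma atens1r f : f ⊠ aid unit_ob = f.
Proof. by case: f => [? ? f|] //=; exact/Arr_arr_eq/tensm1. Qed.

Lemma aid_tens X Y : aid (X ⊗ Y) = aid X ⊠ aid Y.
Proof. by rewrite /aid -tensm_id. Qed.

(** Composability is required factor by factor: equal tensor products may have different factors,
    and then only the right-hand side would be defined. *)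
Lemma atens_comp f f' g g' : composable f' f -> composable g' g ->
  (f' • f) ⊠ (g' • g) = (f' ⊠ g') • (f ⊠ g).
Proof.
move=> [? [? [? [[? ->] [? ->]]]]] [? [? [? [[? ->] [? ->]]]]].
by rewrite -!Arr_comp -tensm_comp.
Qed.

Lemma abraid_nat f g X X' Y Y' : typ f X X' -> typ g Y Y' ->
  abraid X' Y' • (f ⊠ g) = (g ⊠ f) • abraid X Y.
Proof. by move=> [? ->] [? ->]; rewrite -!Arr_comp braid_nat. Qed.

Lemma abraidK X Y : abraid Y X • abraid X Y = aid (X ⊗ Y).
Proof. by rewrite /aid -!Arr_comp braidK. Qed.

(** Untyped form of [midswap], whose rebracketing arrows are no longer visible. *)
Definition amid X Y Z W : arr C := aid X ⊠ (abraid Y Z ⊠ aid W).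

Lemma typ_amid X Y Z W : typ (amid X Y Z W) (X ⊗ Y ⊗ (Z ⊗ W)) (X ⊗ Z ⊗ (Y ⊗ W)).
Proof.
rewrite !tensA -(tensA Y) -(tensA Z).
by apply: typ_tens (typ_aid _) (typ_tens (typ_braid _ _) (typ_aid _)).
Qed.

End Monoidal.

(** * Functor and comonoidal structure on untyped arrows *)

Section FunctorArrows.
Variables (C B : smcat) (F : braided_comonoidal_functor C B).
Implicit Types (X Y Z : C) (f g : arr C).

Definition amap f : arr B :=
  match f with Arr f => Arr (fmap F f) | Undef => Undef end.

Definition aF0 : arr B := Arr (F0 F).

Definition aF2 X Y : arr B := Arr (F2 F X Y).

Lemma typ_map f X Y : typ f X Y -> typ (amap f) (F X) (F Y).
Proof. by move=> [f' ->]; exact: typ_Arr. Qed.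

Lemma typ_F0 : typ aF0 (F unit_ob) unit_ob.
Proof. exact: typ_Arr. Qed.

Lemma typ_F2 X Y : typ (aF2 X Y) (F (X ⊗ Y)) (F X ⊗ F Y).
Proof. exact: typ_Arr. Qed.

End FunctorArrows.

(** * Type inference for untyped expressions *)

Ltac infer_atom := fail.
(** Source and target are read off the syntax; the remaining equations between objects go to
    [objeq], which normalises by the strict monoidal laws. [infer_atom] is a hook for arrows
    introduced later. *)
Ltac infer_typ :=
  lazymatch goal with
  | |- typ (_ • _) _ _ => eapply typ_comp; [infer_typ | infer_typ | objeq]
  | |- typ (_ ⊠ _) _ _ => eapply typ_tens; infer_typ
  | |- typ (aid _) _ _ => apply typ_aid
  | |- typ (abraid _ _) _ _ => apply typ_braid
  | |- typ (amid _ _ _ _) _ _ => apply typ_amid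
  | |- typ (amap _ _) _ _ => eapply typ_map; infer_typ
  | |- typ (aF0 _) _ _ => apply typ_F0
  | |- typ (aF2 _ _ _) _ _ => apply typ_F2
  | |- typ (Arr _) _ _ => apply typ_Arr
  | |- typ _ _ _ => first [eassumption | infer_atom]
  end.
Ltac solve_typ := eapply typ_conv; [infer_typ | objeq | objeq].

#[local] Hint Extern 0 (typ _ _ _) => solve_typ : core.
#[local] Hint Extern 0 (composable _ _) =>
  do 3 eexists; split; [infer_typ | solve_typ] : core.

(** * Coherence of the braiding and of the middle exchange *)

Section Coherence.
Variable C : smcat.
Implicit Types (X Y Z : C) (a b c f g h : arr C).

Lemma abraid_hexagonr X Y Z :
  abraid X (Y ⊗ Z) = (aid Y ⊠ abraid X Z) • (abraid X Y ⊠ aid Z).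
Proof.
have /Arr_arr_eq := braid_hexagon X Y Z.
rewrite /abraid => ->; rewrite !Arr_comp Arr_idto -acompA.
by rewrite acomp1l.
Qed.

(** By the other hexagon the right-hand side is a left inverse of [abraid Z (X ⊗ Y)], and
    [abraid (X ⊗ Y) Z] is its two-sided inverse. *)
Lemma abraid_hexagonl X Y Z :
  abraid (X ⊗ Y) Z = (abraid X Z ⊠ aid Y) • (aid X ⊠ abraid Y Z).
Proof.
transitivity (((abraid X Z ⊠ aid Y) • (aid X ⊠ abraid Y Z)) •
  (abraid Z (X ⊗ Y) • abraid (X ⊗ Y) Z)); last by rewrite abraidK acomp1r.
rewrite acompA abraid_hexagonr !acompA.
rewrite -(acompA _ _ (aid X ⊠ abraid Z Y)).
rewrite -atens_comp // abraidK aid_tens.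
rewrite acomp1l // -!aid_tens acomp1r // -atens_comp // abraidK acomp1l //.
by rewrite -aid_tens acomp1l.
Qed.

(** The hexagon at two unit objects makes this braiding idempotent, and an invertible idempotent is
    the identity. *)
Lemma abraid1r X : abraid X unit_ob = aid X.
Proof.
have idem : abraid X unit_ob = abraid X unit_ob • abraid X unit_ob.
  by have := abraid_hexagonr X unit_ob unit_ob; rewrite tens1o atens1l atens1r.
have K := abraidK X unit_ob; rewrite tenso1 in K.
by rewrite -[LHS](acomp1l (Y := X)) // -K -acompA -idem.
Qed.

Lemma abraid1l X : abraid unit_ob X = aid X.
Proof.
by have := abraidK X unit_ob; rewrite abraid1r tenso1 acomp1r.
Qed.

Lemma atens_exchangel f g X Y : composable f (aid X) -> composable (aid Y) g ->
  (f ⊠ aid Y) • (aid X ⊠ g) = f ⊠ g.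
Proof. by move=> fX Yg; rewrite -atens_comp // acomp1l // acomp1r. Qed.

Lemma atens_exchanger f g X Y : composable (aid X) f -> composable g (aid Y) ->
  (aid X ⊠ g) • (f ⊠ aid Y) = f ⊠ g.
Proof. by move=> Xf gY; rewrite -atens_comp // acomp1l // acomp1r. Qed.

Lemma amid_nat f g h k X X' Y Y' Z Z' W W' :
  typ f X X' -> typ g Y Y' -> typ h Z Z' -> typ k W W' ->
  amid X' Y' Z' W' • ((f ⊠ g) ⊠ (h ⊠ k)) = ((f ⊠ h) ⊠ (g ⊠ k)) • amid X Y Z W.
Proof.
move=> tf tg th tk; rewrite /amid !atensA -(atensA g) -(atensA h) -!atens_comp //.
by rewrite (abraid_nat tg th) !acomp1l // !acomp1r.
Qed.

Lemma atens_compl X f g : composable g f ->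
  aid X ⊠ (g • f) = (aid X ⊠ g) • (aid X ⊠ f).
Proof.
by move=> gf; rewrite -atens_comp // acomp1l.
Qed.

Lemma atens_compr X f g : composable g f ->
  (g • f) ⊠ aid X = (g ⊠ aid X) • (f ⊠ aid X).
Proof.
by move=> gf; rewrite -atens_comp // acomp1l.
Qed.

(** Both sides are the shuffle of three copies of X and three of Y into (X ⊗ Y)^3. Once the outer
    identities are stripped and the hexagons expanded, the two sides differ only in the order of two
    braidings on disjoint factors. *)
Lemma amid_coassoc X Y :
  (aid (X ⊗ Y) ⊠ amid X X Y Y) • amid X (X ⊗ X) Y (Y ⊗ Y)
  = (amid X X Y Y ⊠ aid (X ⊗ Y)) • amid (X ⊗ X) X (Y ⊗ Y) Y.
Proof.
have middle : (aid (Y ⊗ X) ⊠ abraid X Y) • (abraid (X ⊗ X) Y ⊠ aid Y)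
    = (abraid X Y ⊠ aid (Y ⊗ X)) • (aid X ⊠ abraid X (Y ⊗ Y)).
  rewrite abraid_hexagonr abraid_hexagonl atens_compl // atens_compr // !acompA.
  rewrite -!atensA -!aid_tens !atensA -!aid_tens.
  by rewrite atens_exchanger // atens_exchangel.
have := f_equal (fun f => aid X ⊠ f ⊠ aid Y) middle.
by rewrite !atens_compl // !atens_compr // /amid ?aid_tens ?atensA.
Qed.

(** Both sides shuffle X X Y Y Z Z into two copies of X ⊗ Y ⊗ Z; the argument is that of
    [amid_coassoc]. *)
Lemma amid_assoc X Y Z :
  amid (X ⊗ Y) (X ⊗ Y) Z Z • (amid X X Y Y ⊠ aid (Z ⊗ Z))
  = amid X X (Y ⊗ Z) (Y ⊗ Z) • (aid (X ⊗ X) ⊠ amid Y Y Z Z).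
Proof.
have middle : (aid Y ⊠ abraid (X ⊗ Y) Z) • (abraid X Y ⊠ aid (Y ⊗ Z))
    = (abraid X (Y ⊗ Z) ⊠ aid Y) • (aid (X ⊗ Y) ⊠ abraid Y Z).
  rewrite abraid_hexagonr abraid_hexagonl atens_compl // atens_compr // -!acompA.
  rewrite -!atensA -!aid_tens !atensA -!aid_tens.
  by rewrite atens_exchanger // atens_exchangel.
have := f_equal (fun f => aid X ⊠ f ⊠ aid Z) middle.
by rewrite !atens_compl // !atens_compr // /amid ?aid_tens ?atensA.
Qed.

End Coherence.

(** * Comonoids, their tensor products and their morphisms *)

Section Comonoids.
Variable C : smcat.
Implicit Types (M N : C) (D e f g : arr C).

Record acomonoid M D e : Prop := Acomonoid {
  typ_comul : typ D M (M ⊗ M);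
  typ_counit : typ e M unit_ob;
  acomulA : (aid M ⊠ D) • D = (D ⊠ aid M) • D;
  acounitl : (e ⊠ aid M) • D = aid M;
  acounitr : (aid M ⊠ e) • D = aid M
}.

Record acomorphism M D e M' D' e' f : Prop := Acomorphism {
  typ_comorphism : typ f M M';
  acomorphism_comul : (f ⊠ f) • D = D' • f;
  acomorphism_counit : e' • f = e
}.

Definition atens_comul M M' D D' : arr C := amid M M M' M' • (D ⊠ D').

Lemma acomonoidP M (D : hom M (M ⊗ M)) (e : hom M unit_ob) :
  acomonoid M (Arr D) (Arr e) <-> is_comonoid D e.
Proof.
split=> [[_ _ DA el er]|[/Arr_arr_eq DA /Arr_arr_eq el /Arr_arr_eq er]].
  by split; apply: arr_eqE; rewrite !Arr_comp !Arr_tens.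
split; try exact: typ_Arr.
- by move: DA; rewrite !Arr_comp !Arr_tens.
- by move: el; rewrite !Arr_comp !Arr_tens.
- by move: er; rewrite !Arr_comp !Arr_tens.
Qed.

Lemma acomorphismP M M' (D : hom M (M ⊗ M)) (e : hom M unit_ob)
    (D' : hom M' (M' ⊗ M')) (e' : hom M' unit_ob) (f : hom M M') :
  acomorphism M (Arr D) (Arr e) M' (Arr D') (Arr e') (Arr f) ->
  is_comonoid_morphism D e D' e' f.
Proof.
by case=> _ fD fe; split; apply: Arr_inj; rewrite !Arr_comp ?Arr_tens.
Qed.

Lemma Arr_tens_comul M M' (D : hom M (M ⊗ M))
    (D' : hom M' (M' ⊗ M')) :
  Arr (tens_comul D D') = atens_comul M M' (Arr D) (Arr D').
Proof.
by rewrite Arr_comp /midswap Arr_idto_r Arr_idto_l /atens_comul /amid -atensA.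
Qed.

Lemma amid_unitl M N : amid unit_ob M unit_ob N = aid (M ⊗ N).
Proof. by rewrite /amid atens1l abraid1r -aid_tens. Qed.

Lemma amid_unitr M N : amid M unit_ob N unit_ob = aid (M ⊗ N).
Proof. by rewrite /amid abraid1l atens1r -aid_tens. Qed.

(** Naturality moves the middle exchange past the second comultiplication or the counit. What
    remains is [amid_coassoc] for coassociativity, and an exchange with the unit object, hence an
    identity, for the counit laws. *)
Lemma acomonoid_tens M N D D' e e' :
  acomonoid M D e -> acomonoid N D' e' ->
  acomonoid (M ⊗ N) (atens_comul M N D D') (e ⊠ e').
Proof.
case=> tD te DA el er [tD' te' DA' el' er']; rewrite /atens_comul.
split=> //.
- rewrite atens_compl // atens_compr // !acompA.
  rewrite -(acompA _ (aid _ ⊠ _)) -(acompA _ (_ ⊠ aid _)) !aid_tens.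
  rewrite -(amid_nat (typ_aid M) tD (typ_aid N) tD').
  rewrite -(amid_nat tD (typ_aid M) tD' (typ_aid N)).
  rewrite -aid_tens !acompA amid_coassoc -!acompA.
  by congr (_ • (_ • _)); rewrite -!atens_comp // DA DA'.
- rewrite acompA aid_tens -(amid_nat te (typ_aid M) te' (typ_aid N)).
  by rewrite amid_unitl acomp1l // -atens_comp // el el'.
- rewrite acompA aid_tens -(amid_nat (typ_aid M) te (typ_aid N) te').
  by rewrite amid_unitr acomp1l // -atens_comp // er er'.
Qed.

Lemma acomonoid_unit : acomonoid (unit_ob : C) (aid unit_ob) (aid unit_ob).
Proof. by split=> //; rewrite atens1l acomp1l. Qed.

Lemma acomorphism_aid M D e : acomonoid M D e -> acomorphism M D e M D e (aid M).
Proof.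
by case=> tD te _ _ _; split=> //; rewrite ?acomp1r // -aid_tens acomp1l.
Qed.

Lemma acomorphism_counit_unit M D e : acomonoid M D e ->
  acomorphism M D e unit_ob (aid unit_ob) (aid unit_ob) e.
Proof.
case=> tD te _ el _; split; rewrite ?acomp1l //.
by rewrite -(atens_exchanger (X := unit_ob) (Y := M)) // atens1l -acompA el acomp1r.
Qed.

Lemma atens_comul_unitr M D : typ D M (M ⊗ M) ->
  atens_comul M unit_ob D (aid unit_ob) = D.
Proof.
by move=> tD; rewrite /atens_comul /amid abraid1r !atens1r -aid_tens acomp1l.
Qed.

Lemma acomorphism_tens M N M' N' D1 e1 D2 e2 D1' e1' D2' e2' f g :
  acomonoid M D1 e1 -> acomonoid N D2 e2 ->
  acomonoid M' D1' e1' -> acomonoid N' D2' e2' ->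
  acomorphism M D1 e1 M' D1' e1' f -> acomorphism N D2 e2 N' D2' e2' g ->
  acomorphism (M ⊗ N) (atens_comul M N D1 D2) (e1 ⊠ e2)
    (M' ⊗ N') (atens_comul M' N' D1' D2') (e1' ⊠ e2') (f ⊠ g).
Proof.
case=> tD1 te1 _ _ _ [tD2 te2 _ _ _] [tD1' te1' _ _ _] [tD2' te2' _ _ _].
case=> tf fD fe [tg gD ge]; rewrite /atens_comul; split=> //.
  rewrite acompA -(amid_nat tf tf tg tg) -!acompA.
  by congr (_ • _); rewrite -!atens_comp // fD gD.
by rewrite -atens_comp // fe ge.
Qed.

Lemma acomorphism_comp M N P D1 e1 D2 e2 D3 e3 f g :
  acomonoid M D1 e1 -> acomonoid N D2 e2 -> acomonoid P D3 e3 ->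
  acomorphism M D1 e1 N D2 e2 f -> acomorphism N D2 e2 P D3 e3 g ->
  acomorphism M D1 e1 P D3 e3 (g • f).
Proof.
case=> tD1 te1 _ _ _ [tD2 te2 _ _ _] [tD3 te3 _ _ _].
case=> tf fD fe [tg gD ge]; split=> //.
  by rewrite atens_comp // -acompA fD acompA gD acompA.
by rewrite acompA ge.
Qed.

Lemma acomorphism_inverse M N D1 e1 D2 e2 f g :
  acomonoid M D1 e1 -> acomonoid N D2 e2 ->
  acomorphism M D1 e1 N D2 e2 f -> ainverse f g M N ->
  acomorphism N D2 e2 M D1 e1 g.
Proof.
case=> tD1 te1 _ _ _ [tD2 te2 _ _ _] [tf fD fe] [_ [tg [gf fg]]]; split=> //.
  rewrite -[D2](acomp1r (X := N)) // -fg (acompA D2) -fD !acompA.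
  by rewrite -atens_comp // gf -aid_tens acomp1l.
by rewrite -fe -acompA fg acomp1r.
Qed.

Lemma atens_comulA M N P D D' D'' :
  typ D M (M ⊗ M) -> typ D' N (N ⊗ N) -> typ D'' P (P ⊗ P) ->
  atens_comul (M ⊗ N) P (atens_comul M N D D') D''
  = atens_comul M (N ⊗ P) D (atens_comul N P D' D'').
Proof.
move=> tD tD' tD''; rewrite /atens_comul.
(* Identities are inserted on the outer factors so that interchange can separate the exchanges from
   the comultiplications. *)
rewrite -[D'' in LHS](acomp1l (Y := P ⊗ P)) // -[D in RHS](acomp1l (Y := M ⊗ M)) //.
by rewrite !atens_comp // !acompA amid_assoc atensA.
Qed.

(** The middle exchange acts on the two inner outputs of the four-fold comultiplication;
    cocommutativity absorbs it there. *)
Lemma acomorphism_comul_cocomm M D e : acomonoid M D e -> abraid M M • D = D ->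
  acomorphism M D e (M ⊗ M) (atens_comul M M D D) (e ⊠ e) D.
Proof.
case=> tD te DA el er sD; rewrite /atens_comul.
(* Coassociativity is used to let the two inner factors come from a single [D]. *)
have D4 : (D ⊠ D) • D = (aid M ⊠ (D ⊠ aid M)) • ((aid M ⊠ D) • D).
  rewrite -(atens_exchangel (X := M) (Y := M ⊗ M)) // -acompA DA.
  rewrite acompA aid_tens -atensA -atens_comp // acomp1l // -DA.
  by rewrite atens_compr // -acompA -DA atensA.
split=> //.
  rewrite -acompA D4 /amid [in RHS]acompA -atens_comp // -atens_comp // sD.
  by rewrite !acomp1l.
by rewrite -(atens_exchanger (X := unit_ob) (Y := M)) // atens1l -acompA el acomp1r.
Qed.

End Comonoids.

(** * Comonoids under a braided comonoidal functor, and the arrows γ *)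

Section ComonoidalFunctor.
Variables (C B : smcat) (F : braided_comonoidal_functor C B).
Implicit Types (X Y Z M N : C) (f g D e : arr C).
Local Notation map := (amap F).
Local Notation F0 := (aF0 F).
Local Notation F2 := (aF2 F).

Lemma Arr_map X Y (f : hom X Y) : Arr (fmap F f) = map (Arr f).
Proof. by []. Qed.

Lemma amap_id X : map (aid X) = aid (F X).
Proof. by rewrite /= fmap_id. Qed.

Lemma amap_comp f g : composable g f -> map (g • f) = map g • map f.
Proof.
by move=> [? [? [? [[? ->] [? ->]]]]]; rewrite -Arr_comp /= fmap_comp Arr_comp.
Qed.

Lemma aF2_nat f g X X' Y Y' : typ f X X' -> typ g Y Y' ->
  F2 X' Y' • map (f ⊠ g) = (map f ⊠ map g) • F2 X Y.
Proof.
by move=> [f' ->] [g' ->]; rewrite /aF2 /= -!Arr_comp F2_nat.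
Qed.

Lemma aF2_coassoc X Y Z :
  (aid (F X) ⊠ F2 Y Z) • F2 X (Y ⊗ Z) = (F2 X Y ⊠ aid (F Z)) • F2 (X ⊗ Y) Z.
Proof. by rewrite /aF2 /= -!Arr_comp; exact/Arr_arr_eq/F2_coassoc. Qed.

Lemma aF2_braid X Y :
  abraid (F X) (F Y) • F2 X Y = F2 Y X • map (abraid X Y).
Proof. by rewrite /aF2 /= -!Arr_comp F2_braid. Qed.

Lemma aF2_counitl X : (F0 ⊠ aid (F X)) • F2 unit_ob X = aid (F X).
Proof. by rewrite /aF2 /= -!Arr_comp; exact/Arr_arr_eq/F2_counitl. Qed.

Lemma aF2_counitr X : (aid (F X) ⊠ F0) • F2 X unit_ob = aid (F X).
Proof. by rewrite /aF2 /= -!Arr_comp; exact/Arr_arr_eq/F2_counitr. Qed.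

(** The four-fold splitting is rearranged so that F(Y ⊗ Z) is split last, which isolates the place
    where the braiding acts. *)
Lemma aF2_middle X Y Z W :
  (F2 X Y ⊠ F2 Z W) • F2 (X ⊗ Y) (Z ⊗ W)
  = (aid (F X) ⊠ (F2 Y Z ⊠ aid (F W))) • ((F2 X (Y ⊗ Z) ⊠ aid (F W)) •
      F2 (X ⊗ (Y ⊗ Z)) W).
Proof.
rewrite -(atens_exchangel (X := F (X ⊗ Y)) (Y := F Z ⊗ F W)) // -acompA aF2_coassoc.
rewrite acompA aid_tens -atensA -atens_compr // -aF2_coassoc tensA.
by rewrite atens_compr // -acompA atensA.
Qed.

(** In the form given by [aF2_middle], the exchange meets only the splitting of the two middle
    objects, where [aF2_braid] applies. *)
Lemma aF2_amid X Y Z W :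
  (F2 X Z ⊠ F2 Y W) • F2 (X ⊗ Z) (Y ⊗ W) • map (amid X Y Z W)
  = amid (F X) (F Y) (F Z) (F W) • (F2 X Y ⊠ F2 Z W) • F2 (X ⊗ Y) (Z ⊗ W).
Proof.
rewrite aF2_middle -[RHS]acompA [in RHS]aF2_middle.
rewrite [RHS]acompA -atens_comp // -atens_comp // aF2_braid.
have tmid : typ (aid X ⊠ abraid Y Z) (X ⊗ (Y ⊗ Z)) (X ⊗ (Z ⊗ Y)) by [].
rewrite /amid -!acompA -(atensA (aid X)) (aF2_nat tmid (typ_aid W)).
rewrite [in LHS](acompA (_ ⊠ _) (_ ⊠ _) (F2 _ _)) -atens_comp //.
rewrite (aF2_nat (typ_aid X) (typ_braid Y Z)).
rewrite !amap_id !acomp1l // !acompA.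
by rewrite !atens_compr // atens_compl // atensA !acompA.
Qed.

Definition amap_comul M D : arr B := F2 M M • map D.

Definition amap_counit e : arr B := F0 • map e.

(** By naturality of [F2], each law is the matching coherence law of F composed with the image of
    the law in C. *)
Lemma acomonoid_map M D e : acomonoid M D e ->
  acomonoid (F M) (amap_comul M D) (amap_counit e).
Proof.
case=> tD te DA el er; rewrite /amap_comul /amap_counit; split=> //.
- rewrite atens_compl // atens_compr //.
  rewrite -!acompA (acompA _ (F2 M M)) [in RHS](acompA _ (F2 M M)).
  rewrite -{2 4}amap_id -(aF2_nat (typ_aid M) tD) -(aF2_nat tD (typ_aid M)).
  by rewrite -!acompA -!amap_comp // DA !acompA aF2_coassoc.
- rewrite atens_compr // -acompA (acompA _ (F2 M M)) -amap_id.
  rewrite -(aF2_nat te (typ_aid M)) -acompA -amap_comp // el.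
  by rewrite amap_id acomp1r // aF2_counitl.
- rewrite atens_compl // -acompA (acompA _ (F2 M M)) -amap_id.
  rewrite -(aF2_nat (typ_aid M) te) -acompA -amap_comp // er.
  by rewrite amap_id acomp1r // aF2_counitr.
Qed.

Lemma acomorphism_map M N D e D' e' f : acomonoid M D e -> acomonoid N D' e' ->
  acomorphism M D e N D' e' f ->
  acomorphism (F M) (amap_comul M D) (amap_counit e)
    (F N) (amap_comul N D') (amap_counit e') (map f).
Proof.
case=> tD te _ _ _ [tD' te' _ _ _] [tf fD fe].
rewrite /amap_comul /amap_counit; split=> //.
  by rewrite acompA -(aF2_nat tf tf) -!acompA -!amap_comp // fD.
by rewrite -acompA -amap_comp // fe.
Qed.

Lemma aF0_F2 : (F0 ⊠ F0) • F2 unit_ob unit_ob = F0.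
Proof.
rewrite -(atens_exchanger (X := unit_ob) (Y := F unit_ob)) // atens1l.
by rewrite -acompA aF2_counitl acomp1r.
Qed.

Lemma acomorphism_F2 M N D e D' e' : acomonoid M D e -> acomonoid N D' e' ->
  acomorphism (F (M ⊗ N)) (amap_comul (M ⊗ N) (atens_comul M N D D'))
      (amap_counit (e ⊠ e'))
    (F M ⊗ F N) (atens_comul (F M) (F N) (amap_comul M D) (amap_comul N D'))
      (amap_counit e ⊠ amap_counit e')
    (F2 M N).
Proof.
case=> tD te _ _ _ [tD' te' _ _ _].
rewrite /amap_comul /amap_counit /atens_comul; split=> //.
  rewrite amap_comp // !acompA aF2_amid -!acompA (aF2_nat tD tD') !acompA.
  by congr (_ • _); rewrite -!acompA -atens_comp.
by rewrite atens_comp // -acompA -(aF2_nat te te') acompA aF0_F2.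
Qed.

Definition agamma M D X Y : arr B :=
  F2 (X ⊗ M) (M ⊗ Y) • map (aid X ⊠ D ⊠ aid Y).

(** Under F stands a tensor product of comonoid morphisms, [D] being one by cocommutativity; it is
    followed by [F2], which is one by [acomorphism_F2]. *)
Lemma acomorphism_gamma M D e X DX eX Y DY eY :
  acomonoid M D e -> abraid M M • D = D ->
  acomonoid X DX eX -> acomonoid Y DY eY ->
  acomorphism
    (F (X ⊗ M ⊗ Y))
      (amap_comul (X ⊗ M ⊗ Y) (atens_comul (X ⊗ M) Y (atens_comul X M DX D) DY))
      (amap_counit (eX ⊠ e ⊠ eY))
    (F (X ⊗ M) ⊗ F (M ⊗ Y))
      (atens_comul (F (X ⊗ M)) (F (M ⊗ Y))
         (amap_comul (X ⊗ M) (atens_comul X M DX D))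
         (amap_comul (M ⊗ Y) (atens_comul M Y D DY)))
      (amap_counit (eX ⊠ e) ⊠ amap_counit (e ⊠ eY))
    (agamma M D X Y).
Proof.
move=> cM sM cX cY.
have cXM := acomonoid_tens cX cM; have cMY := acomonoid_tens cM cY.
have cMM := acomonoid_tens cM cM.
have := acomorphism_tens (acomonoid_tens cX cM) cY (acomonoid_tens cX cMM) cY
  (acomorphism_tens cX cM cX cMM (acomorphism_aid cX)
     (acomorphism_comul_cocomm cM sM)) (acomorphism_aid cY).
case: (cX) (cM) (cY) => tDX _ _ _ _ [tD _ _ _ _] [tDY _ _ _ _].
(* The target comonoid is rebracketed into the halves X ⊗ M and M ⊗ Y at which [F2] splits. *)
have cE :
    atens_comul (X ⊗ (M ⊗ M)) Y
      (atens_comul X (M ⊗ M) DX (atens_comul M M D D)) DY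
    = atens_comul (X ⊗ M) (M ⊗ Y) (atens_comul X M DX D) (atens_comul M Y D DY).
  by rewrite -(atens_comulA tDX tD tD) -tensA atens_comulA // /atens_comul.
rewrite cE -(tensA X M M) -(atensA eX) (tensA (X ⊗ M) M Y) (atensA (_ ⊠ e)).
move/(acomorphism_map (acomonoid_tens cXM cY) (acomonoid_tens cXM cMY)) => gM.
apply: acomorphism_comp gM (acomorphism_F2 cXM cMY).
- by apply: acomonoid_map; exact: acomonoid_tens.
- by apply: acomonoid_map; exact: acomonoid_tens.
- by apply: acomonoid_tens; exact: acomonoid_map.
Qed.

Lemma agamma_nat M D X Y X' Y' f g :
  typ D M (M ⊗ M) -> typ f X X' -> typ g Y Y' ->
  (map (f ⊠ aid M) ⊠ map (aid M ⊠ g)) • agamma M D X Y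
  = agamma M D X' Y' • map (f ⊠ aid M ⊠ g).
Proof.
move=> tD tf tg; rewrite /agamma acompA -!acompA -amap_comp //.
have tfM : typ (f ⊠ aid M) (X ⊗ M) (X' ⊗ M) by [].
have tMg : typ (aid M ⊠ g) (M ⊗ Y) (M ⊗ Y') by [].
rewrite acompA -(aF2_nat tfM tMg) -acompA -amap_comp //; congr (_ • map _).
rewrite !atensA -(atensA (aid M) (aid M)) -aid_tens.
by rewrite -!atens_comp // !acomp1l // !acomp1r.
Qed.

(** A word can be cut at M and at N in either order: [F2] is coassociative, and the two duplications
    act on disjoint factors. *)
Lemma agamma_coassoc M D N D' X Y : typ D M (M ⊗ M) -> typ D' N (N ⊗ N) ->
  (aid (F (X ⊗ M)) ⊠ agamma N D' M Y) • agamma M D X (N ⊗ Y)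
  = (agamma M D X N ⊠ aid (F (N ⊗ Y))) • agamma N D' (X ⊗ M) Y.
Proof.
move=> tD tD'; rewrite /agamma atens_compl // atens_compr //.
have t1 : typ (aid X ⊠ D ⊠ aid N) (X ⊗ M ⊗ N) ((X ⊗ M) ⊗ (M ⊗ N)) by [].
have t2 : typ (aid M ⊠ D' ⊠ aid Y) (M ⊗ (N ⊗ Y)) ((M ⊗ N) ⊗ (N ⊗ Y)) by [].
rewrite -!acompA (acompA _ (F2 _ _)) [in RHS](acompA _ (F2 _ _)) -!amap_id.
rewrite -(aF2_nat (typ_aid _) t2) -(aF2_nat t1 (typ_aid _)).
rewrite -!acompA -!amap_comp // !amap_id !acompA aF2_coassoc.
rewrite -!acompA; congr (_ • (_ • map _)).
transitivity ((aid X ⊠ D) ⊠ (D' ⊠ aid Y)).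
  rewrite -[RHS](atens_exchanger (X := X ⊗ (M ⊗ M)) (Y := N ⊗ Y)) //.
  by rewrite ?aid_tens ?atensA.
rewrite -[LHS](atens_exchangel (X := X ⊗ M) (Y := N ⊗ (N ⊗ Y))) //.
by rewrite ?aid_tens ?atensA.
Qed.

End ComonoidalFunctor.

(** * The Hopf category of adapted cocommutative comonoids *)

Section Construction.
Variables (C B : smcat) (F : braided_comonoidal_functor C B).
Implicit Types (x y z w : adapted_cocomm_comonoid F) (X Y : C).
Local Notation map := (amap F).
Local Notation Δ x := (Arr (comul (acc_comonoid x))).
Local Notation ε x := (Arr (counit (acc_comonoid x))).

Local Notation hom_comul x y := (amap_comul F (x ⊗ y) (atens_comul x y (Δ x) (Δ y))).
Local Notation hom_counit x y := (amap_counit F (ε x ⊠ ε y)).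

Lemma adapted_acomonoid x : acomonoid x (Δ x) (ε x).
Proof. exact/acomonoidP/comonoidP. Qed.

Lemma adapted_cocomm x : abraid x x • Δ x = Δ x.
Proof. by rewrite -Arr_comp; congr Arr; exact: acc_cocomm. Qed.

Definition agammaV y X Y : arr B := Arr (inv (gamma_invertible (acc_adapted y) X Y)).

Definition achiV x : arr B := Arr (inv (chi_invertible (acc_adapted x))).

Lemma agammaVP y X Y :
  ainverse (agamma F y (Δ y) X Y) (agammaV y X Y)
    (F (X ⊗ y ⊗ Y)) (F (X ⊗ y) ⊗ F (y ⊗ Y)).
Proof.
have := ainverse_inv (gamma_invertible (acc_adapted y) X Y).
by rewrite /gamma Arr_comp Arr_map Arr_idto_l.
Qed.

Lemma achiVP x : ainverse (amap_counit F (ε x)) (achiV x) (F x) unit_ob.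
Proof.
have := ainverse_inv (chi_invertible (acc_adapted x)).
by rewrite /chi Arr_comp.
Qed.

(** The outer objects range over all of C, because associativity passes through the end objects x ⊗
    y and z ⊗ w. *)
Definition amul y X Y : arr B := map (aid X ⊠ ε y ⊠ aid Y) • agammaV y X Y.

Definition aunit x : arr B := map (Δ x) • achiV x.

Lemma Arr_hopf_mul x y z : Arr (hopf_mul x y z) = amul y x z.
Proof. by rewrite Arr_comp Arr_map Arr_idto_l. Qed.

Lemma Arr_hopf_unit x : Arr (hopf_unit x) = aunit x.
Proof. by rewrite Arr_comp. Qed.

Lemma Arr_hopf_comul x y :
  Arr (hopf_comul x y) = hom_comul x y.
Proof.
rewrite !Arr_comp !Arr_map /midswap Arr_idto_r Arr_idto_l.
by rewrite /amap_comul /atens_comul amap_comp // -acompA /amid -atensA.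
Qed.

Lemma Arr_hopf_counit x y : Arr (hopf_counit x y) = hom_counit x y.
Proof. by rewrite Arr_comp Arr_map Arr_idto_l. Qed.

Lemma typ_gammaV y X Y : typ (agammaV y X Y) (F (X ⊗ y) ⊗ F (y ⊗ Y)) (F (X ⊗ y ⊗ Y)).
Proof. exact: typ_Arr. Qed.

Lemma typ_chiV x : typ (achiV x) unit_ob (F x).
Proof. exact: typ_Arr. Qed.

Lemma typ_mul y X Y : typ (amul y X Y) (F (X ⊗ y) ⊗ F (y ⊗ Y)) (F (X ⊗ Y)).
Proof. by have tV := typ_gammaV y X Y; rewrite /amul. Qed.

Lemma typ_unit x : typ (aunit x) unit_ob (F (x ⊗ x)).
Proof. by have tV := typ_chiV x; rewrite /aunit. Qed.

Local Notation γ y := (agamma F y (Δ y)).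

Lemma typ_gamma y X Y : typ (γ y X Y) (F (X ⊗ y ⊗ Y)) (F (X ⊗ y) ⊗ F (y ⊗ Y)).
Proof. by rewrite /agamma. Qed.

Ltac infer_atom ::=
  first [apply typ_gamma | apply typ_gammaV | apply typ_chiV
        | apply typ_mul | apply typ_unit].

Lemma amul_gamma y X Y : amul y X Y • γ y X Y = map (aid X ⊠ ε y ⊠ aid Y).
Proof.
by have [_ [_ [K _]]] := agammaVP y X Y; rewrite /amul -acompA K acomp1r.
Qed.

(** Inherited from [agamma_nat] after inserting γ and its inverse on the right. *)
Lemma amul_nat y f g X Y X' Y' : typ f X X' -> typ g Y Y' ->
  amul y X' Y' • (map (f ⊠ aid y) ⊠ map (aid y ⊠ g)) = map (f ⊠ g) • amul y X Y.
Proof.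
move=> tf tg; have [_ [_ [VK GV]]] := agammaVP y X Y.
rewrite -[LHS](acomp1r (X := F (X ⊗ y) ⊗ F (y ⊗ Y))) // -GV.
rewrite acompA -(acompA _ _ (γ y X Y)) (agamma_nat _ (typ_Arr _) tf tg).
rewrite acompA amul_gamma -amap_comp // /amul [RHS]acompA -amap_comp //.
by congr (map _ • _); rewrite -[f in RHS]atens1r -!atens_comp // !acomp1l // !acomp1r.
Qed.

(** A counit law of [x] makes γ with left end I a section of χ ⊗ id; the unit law is tested on this
    section. *)
Lemma chi_gammal x Y :
  (amap_counit F (ε x) ⊠ aid (F (x ⊗ Y))) • γ x unit_ob Y = aid (F (x ⊗ Y)).
Proof.
have [tD te _ el _] := adapted_acomonoid x.
rewrite /amap_counit /agamma tens1o atens1l atens_compr // -acompA.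
rewrite (acompA _ (aF2 _ _ _)) -(amap_id F) -(aF2_nat F te (typ_aid _)).
rewrite -acompA -amap_comp // aid_tens -atensA -atens_compr // el.
by rewrite -aid_tens amap_id acomp1r // aF2_counitl.
Qed.

Lemma chi_gammar x X :
  (aid (F (X ⊗ x)) ⊠ amap_counit F (ε x)) • γ x X unit_ob = aid (F (X ⊗ x)).
Proof.
have [tD te _ _ er] := adapted_acomonoid x.
rewrite /amap_counit /agamma tenso1 atens1r atens_compl // -acompA.
rewrite (acompA _ (aF2 _ _ _)) -(amap_id F) -(aF2_nat F (typ_aid _) te).
rewrite -acompA -amap_comp // aid_tens atensA -atens_compl // er.
by rewrite -aid_tens amap_id acomp1r // aF2_counitr.
Qed.

(** By naturality of [F2] this is the image of coassociativity of [x]. *)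
Lemma comul_gammal x Y :
  (map (Δ x) ⊠ aid (F (x ⊗ Y))) • γ x unit_ob Y = γ x x Y • map (Δ x ⊠ aid Y).
Proof.
have [tD te DA _ _] := adapted_acomonoid x.
rewrite /agamma tens1o atens1l acompA -amap_id -(aF2_nat F tD (typ_aid _)).
rewrite -!acompA -!amap_comp // aid_tens -atensA -!atens_compr //.
by rewrite DA.
Qed.

Lemma comul_gammar x X :
  (aid (F (X ⊗ x)) ⊠ map (Δ x)) • γ x X unit_ob = γ x X x • map (aid X ⊠ Δ x).
Proof.
have [tD te DA _ _] := adapted_acomonoid x.
rewrite /agamma tenso1 atens1r acompA -amap_id -(aF2_nat F (typ_aid _) tD).
rewrite -!acompA -!amap_comp // aid_tens !atensA -!atens_compl //.
by rewrite DA.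
Qed.

(** Holds by conversion; stated before [agamma] becomes opaque, to fold γ in the antipode
    computations. *)
Lemma agammaE y X Y :
  aF2 F (X ⊗ y) (y ⊗ Y) • map (aid X ⊠ Δ y ⊠ aid Y) = γ y X Y.
Proof. by []. Qed.

#[local] Opaque agamma amul.

Lemma amul_assoc x y z w :
  amul z x w • (amul y x z ⊠ aid (F (z ⊗ w)))
  = amul y x w • (aid (F (x ⊗ y)) ⊠ amul z y w).
Proof.
have [_ [_ [_ GV]]] := agammaVP y x (z ⊗ w).
have [_ [_ [_ GV']]] := agammaVP z y w.
pose G := (aid (F (x ⊗ y)) ⊠ γ z y w) • γ y x (z ⊗ w).
pose T := F (x ⊗ y) ⊗ (F (y ⊗ z) ⊗ F (z ⊗ w)).
(* Both sides are compared after precomposition with the split epimorphism G. *)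
have [V [tV GK]] : exists V, typ V T (F (x ⊗ y ⊗ (z ⊗ w))) /\ G • V = aid T.
  exists (agammaV y x (z ⊗ w) • (aid (F (x ⊗ y)) ⊠ agammaV z y w)).
  rewrite /T; split=> //.
  rewrite /G acompA -(acompA _ (γ y _ _)) GV acomp1r // -atens_compl // GV'.
  by rewrite -aid_tens.
rewrite -[LHS](acomp1r (X := T)) /T // -[RHS](acomp1r (X := T)) /T // -/T.
rewrite -GK [LHS]acompA [RHS]acompA; congr (_ • _); rewrite /G.
have t1 : typ (aid x ⊠ ε y) (x ⊗ y) x by [].
have t2 : typ (ε z ⊠ aid w) (z ⊗ w) w by [].
transitivity (map (aid x ⊠ ε y ⊠ ε z ⊠ aid w)).
  rewrite agamma_coassoc // -acompA [_ ⊠ _ • _]acompA -atens_compr // amul_gamma.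
  rewrite -amap_id aid_tens [LHS]acompA (amul_nat _ t1 (typ_aid _)).
  rewrite -acompA amul_gamma -amap_comp //.
  by rewrite (atensA _ (ε z)) atens_exchangel // !atensA.
rewrite -acompA [_ ⊠ _ • _]acompA -atens_compl // amul_gamma -amap_id.
rewrite aid_tens (atensA (aid y)) [RHS]acompA (amul_nat _ (typ_aid _) t2).
rewrite -acompA amul_gamma -amap_comp //.
by rewrite atens_exchanger // !atensA.
Qed.

Lemma aunit_chi x : aunit x • amap_counit F (ε x) = map (Δ x).
Proof.
have [_ [_ [K _]]] := achiVP x.
by rewrite /aunit -acompA K acomp1r.
Qed.

Lemma typ_chi x : typ (amap_counit F (ε x)) (F x) unit_ob.
Proof. by rewrite /amap_counit. Qed.

Lemma amul1l x Y : amul x x Y • (aunit x ⊠ aid (F (x ⊗ Y))) = aid (F (x ⊗ Y)).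
Proof.
have tchi := typ_chi x; have [_ _ _ _ er] := adapted_acomonoid x.
(* The inserted factor is the identity by [chi_gammal]; its χ cancels the inverse in [aunit], and
   its γ is moved next to [amul]. *)
transitivity (amul x x Y • (aunit x ⊠ aid (F (x ⊗ Y))) •
  ((amap_counit F (ε x) ⊠ aid (F (x ⊗ Y))) • γ x unit_ob Y)).
  by rewrite chi_gammal acomp1r.
rewrite -acompA (acompA (_ ⊠ _)) -atens_compr // aunit_chi comul_gammal [LHS]acompA.
by rewrite amul_gamma -amap_comp // -atens_compr // er -aid_tens amap_id.
Qed.

Lemma amul1r x X : amul x X x • (aid (F (X ⊗ x)) ⊠ aunit x) = aid (F (X ⊗ x)).
Proof.
have tchi := typ_chi x; have [_ _ _ el _] := adapted_acomonoid x.
transitivity (amul x X x • (aid (F (X ⊗ x)) ⊠ aunit x) •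
  ((aid (F (X ⊗ x)) ⊠ amap_counit F (ε x)) • γ x X unit_ob)).
  by rewrite chi_gammar acomp1r.
rewrite -acompA (acompA (_ ⊠ _)) -atens_compl // aunit_chi comul_gammar [LHS]acompA.
by rewrite amul_gamma -amap_comp // atensA -atens_compl // el -aid_tens amap_id.
Qed.

(** The hexagon fuses the braiding and the middle exchange into one braiding of [x] past y ⊗ y.
    Naturality then puts the comultiplication of [y] last, as γ requires. *)
Lemma antipoder_braiding x y :
  (aid (x ⊗ y) ⊠ abraid x y) • atens_comul x y (Δ x) (Δ y)
  = (aid x ⊠ Δ y ⊠ aid x) • ((aid x ⊠ abraid x y) • (Δ x ⊠ aid y)).
Proof.
rewrite /atens_comul /amid acompA aid_tens atensA -atens_compl //.
rewrite -abraid_hexagonr -[Δ x ⊠ Δ y](atens_exchanger (X := x ⊗ x) (Y := y)) //.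
rewrite aid_tens !acompA !atensA -!atens_compl //.
by rewrite (abraid_nat (typ_aid x) (typ_Arr (comul y))).
Qed.

Lemma antipodel_braiding x y :
  (abraid x y ⊠ aid (x ⊗ y)) • atens_comul x y (Δ x) (Δ y)
  = (aid y ⊠ Δ x ⊠ aid y) • ((abraid x y ⊠ aid y) • (aid x ⊠ Δ y)).
Proof.
rewrite /atens_comul /amid acompA aid_tens -!atensA -atens_compr //.
rewrite -abraid_hexagonl -[Δ x ⊠ Δ y](atens_exchangel (X := x) (Y := y ⊗ y)) //.
rewrite aid_tens !acompA -!atensA -!atens_compr //.
by rewrite (abraid_nat (typ_Arr (comul x)) (typ_aid y)).
Qed.

Lemma aantipoder x y :
  amul y x x • (aid (F (x ⊗ y)) ⊠ map (abraid x y))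
    • hom_comul x y
  = aunit x • hom_counit x y.
Proof.
have tchi := typ_chi x.
have [tD te _ _ _] := acomonoid_tens (adapted_acomonoid x) (adapted_acomonoid y).
rewrite /amap_comul -[LHS]acompA [_ ⊠ _ • _]acompA -(amap_id F).
rewrite -(aF2_nat F (typ_aid _) (typ_braid x y)) -[_ • _ • map _]acompA -amap_comp //.
rewrite antipoder_braiding amap_comp // (acompA (aF2 _ _ _)) agammaE.
rewrite [LHS]acompA amul_gamma -amap_comp // acompA atensA -atens_compl //.
(* Discarding [y] before the braiding leaves a braiding of [x] with the unit object, which is the
   identity. *)
rewrite -(abraid_nat (typ_aid x) (typ_Arr (counit y))) abraid1r acomp1l //.
rewrite -atensA -aid_tens (atens_exchanger (X := x ⊗ x)) //.
(* On the other side too [y] is discarded first, so that the rest of the counit is χ at [x] and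
   cancels against the unit. *)
rewrite /amap_counit -[ε x ⊠ ε y](atens_exchangel (X := x) (Y := unit_ob)) // atens1r.
rewrite amap_comp // (acompA (aF0 F)) acompA aunit_chi -amap_comp //.
by congr map; rewrite -[Δ x in RHS]atens1r atens_exchangel.
Qed.

Lemma aantipodel x y :
  amul x y y • (map (abraid x y) ⊠ aid (F (x ⊗ y)))
    • hom_comul x y
  = aunit y • hom_counit x y.
Proof.
have tchi := typ_chi x.
have [tD te _ _ _] := acomonoid_tens (adapted_acomonoid x) (adapted_acomonoid y).
rewrite /amap_comul -[LHS]acompA [_ ⊠ _ • _]acompA -(amap_id F).
rewrite -(aF2_nat F (typ_braid x y) (typ_aid _)) -[_ • _ • map _]acompA -amap_comp //.
rewrite antipodel_braiding amap_comp // (acompA (aF2 _ _ _)) agammaE.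
rewrite [LHS]acompA amul_gamma -amap_comp // acompA -atens_compr //.
(* Mirror image of the other antipode law: now [x] is discarded before the braiding. *)
rewrite -(abraid_nat (typ_Arr (counit x)) (typ_aid y)) abraid1l acomp1l //.
rewrite atensA -aid_tens (atens_exchangel (Y := y ⊗ y)) //.
rewrite /amap_counit -[ε x ⊠ ε y](atens_exchanger (X := unit_ob) (Y := y)) // atens1l.
rewrite amap_comp // (acompA (aF0 F)) acompA aunit_chi -amap_comp //.
by congr map; rewrite -[Δ y in RHS]atens1l atens_exchanger.
Qed.

Lemma acomonoid_hom x y : acomonoid (F (x ⊗ y)) (hom_comul x y) (hom_counit x y).
Proof.
by apply: acomonoid_map; apply: acomonoid_tens; exact: adapted_acomonoid.
Qed.

Lemma acomorphism_mul x y z :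
  acomorphism (F (x ⊗ y) ⊗ F (y ⊗ z))
      (atens_comul (F (x ⊗ y)) (F (y ⊗ z)) (hom_comul x y) (hom_comul y z))
      (hom_counit x y ⊠ hom_counit y z)
    (F (x ⊗ z)) (hom_comul x z) (hom_counit x z) (amul y x z).
Proof.
have cx := adapted_acomonoid x; have cy := adapted_acomonoid y.
have cz := adapted_acomonoid z.
have cxy := acomonoid_tens cx cy; have cxyz := acomonoid_tens cxy cz.
have cx1 := acomonoid_tens cx (acomonoid_unit C).
have [tx _ _ _ _] := cx.
have := acomorphism_tens cxy cz cx1 cz (acomorphism_tens cx cy cx (acomonoid_unit C)
  (acomorphism_aid cx) (acomorphism_counit_unit cy)) (acomorphism_aid cz).
(* Discarding [y] lands in the comonoid x ⊗ I ⊗ z; here x ⊗ I is identified with [x], comonoid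
   structure included. *)
rewrite (atens_comul_unitr tx) tenso1 atens1r.
move/(acomorphism_map F cxyz (acomonoid_tens cx cz)).
apply: acomorphism_comp.
- exact: acomonoid_tens (acomonoid_hom x y) (acomonoid_hom y z).
- exact: acomonoid_map.
- exact: acomonoid_hom.
- apply: acomorphism_inverse (agammaVP y x z).
  + exact: acomonoid_map.
  + exact: acomonoid_tens (acomonoid_hom x y) (acomonoid_hom y z).
  + exact: acomorphism_gamma (adapted_cocomm y) cx cz.
Qed.

Lemma acomorphism_aunit x :
  acomorphism unit_ob (aid unit_ob) (aid unit_ob)
    (F (x ⊗ x)) (hom_comul x x) (hom_counit x x) (aunit x).
Proof.
have cx := adapted_acomonoid x.
have cFx := acomonoid_map F cx; have c1 := acomonoid_unit C.
have chiM : acomorphism (F x) (amap_comul F x (Δ x)) (amap_counit F (ε x))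
    unit_ob (aid unit_ob) (aid unit_ob) (amap_counit F (ε x)).
  apply: (acomorphism_comp cFx (acomonoid_map F c1) (acomonoid_unit B)
    (acomorphism_map F cx c1 (acomorphism_counit_unit cx))).
  have := acomorphism_counit_unit (acomonoid_map F c1).
  by rewrite /amap_counit amap_id acomp1r.
apply: (acomorphism_comp (acomonoid_unit B) cFx (acomonoid_hom x x)).
  exact: (acomorphism_inverse cFx (acomonoid_unit B) chiM (achiVP x)).
apply: (acomorphism_map F cx (acomonoid_tens cx cx)).
exact: acomorphism_comul_cocomm cx (adapted_cocomm x).
Qed.

End Construction.

Theorem theorem15 (C B : smcat) (F : braided_comonoidal_functor C B) :
  is_hopf_category
    (fun x y : adapted_cocomm_comonoid F => hopf_hom x y)
    (fun x y z => hopf_mul x y z)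
    (fun x => hopf_unit x)
    (fun x y => hopf_comul x y)
    (fun x y => hopf_counit x y)
    (fun x y => hopf_antipode x y).
Proof.
split; first split; first split.
- move=> x y z w; apply: arr_eqE.
  rewrite [LHS]Arr_comp [RHS]Arr_comp !Arr_tens !Arr_hopf_mul; exact: amul_assoc.
- move=> x y; apply: arr_eqE.
  rewrite [LHS]Arr_comp Arr_tens Arr_hopf_mul Arr_hopf_unit; exact: amul1l.
- move=> x y; apply: arr_eqE.
  rewrite [LHS]Arr_comp Arr_tens Arr_hopf_mul Arr_hopf_unit; exact: amul1r.
- move=> x y; apply/acomonoidP.
  rewrite Arr_hopf_comul Arr_hopf_counit; exact: acomonoid_hom.
- move=> x y z; apply: acomorphismP.
  rewrite Arr_tens_comul /tens_counit Arr_idto_l Arr_tens.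
  rewrite !Arr_hopf_comul !Arr_hopf_counit Arr_hopf_mul; exact: acomorphism_mul.
- move=> x; apply: acomorphismP.
  rewrite /unit_comul Arr_idto Arr_hopf_comul Arr_hopf_counit Arr_hopf_unit.
  exact: acomorphism_aunit.
- move=> x y; apply: Arr_inj.
  rewrite Arr_comp [X in X • _]Arr_comp Arr_tens [RHS]Arr_comp.
  rewrite Arr_hopf_mul Arr_hopf_unit Arr_hopf_comul.
  rewrite Arr_hopf_counit; exact: aantipoder.
- move=> x y; apply: Arr_inj.
  rewrite Arr_comp [X in X • _]Arr_comp Arr_tens [RHS]Arr_comp.
  rewrite Arr_hopf_mul Arr_hopf_unit Arr_hopf_comul.
  rewrite Arr_hopf_counit; exact: aantipodel.
Qed.
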